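(* Let $G\subset S_n$ be a transitive permutation group, $\mathrm{inv}$ a counting invariant with exponent function $\exp$, and $Q$ a global field with $\gcd(|G|,\mathrm{char}(Q))=1$. Let $d=\mathrm{lcm}\{\mathrm{ord}(g): \exp(g)=\exp(G)\}$. Then $$b_T(G^{\mathrm{inv}},Q)=\max_{\pi,\phi}\ b(\pi,\phi),$$ where the maximum is taken only over those pairs $(\pi,\phi)$ such that $\pi:G\to G/N$ is a quotient map with $\exp(\mathrm{Ker}(\pi))=\exp(G)$ and $\phi:G_Q\to G/N$ is a continuous surjection that factors through $\mathrm{Gal}(Q(\mu_d)/Q)\to G/N$.
   Context: The exponent function of a counting invariant is a function $\exp$ from the nonidentity conjugacy classes of $G$ to $\mathbb{Z}_{>0}$ such that $\exp(g)=\exp(g^k)$ whenever $\gcd(k,\mathrm{ord}(g))=1$; it records the exponent of $|v|$ in $\mathrm{inv}(K)$ when the tame inertia generator at a place $v\nmid |G|\infty$ is $g$ (the remaining local data of $\mathrm{inv}$, at places dividing $|G|\infty$, plays no role here). For the discriminant, $\exp(g)=\mathrm{ind}(g)=n-\#\{\text{cycles of } g\}$. For a nontrivial subgroup $N\subseteq G$, $\exp(N)=\min_{e\neq g\in N}\exp(g)$. Definition of $b(\pi,\phi)$. Let $N\trianglelefteq G$, $\pi:G\to G/N$ the quotient map, and $\phi:G_Q\to G/N$ a continuous surjection. Let $Q(\phi)$ be the fixed field of $\ker\phi$, $M(\phi)=Q(\phi)\cap Q(\mu_d)$, and let $$G(\pi,\phi)\subset G\times\mathrm{Gal}(Q(\mu_d)/Q)\subset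 G\times(\mathbb{Z}/d\mathbb{Z})^\times$$ be the fibre product over $\mathrm{Gal}(M(\phi)/Q)$ of $G\xrightarrow{\pi}G/N\simeq\mathrm{Gal}(Q(\phi)/Q)\to\mathrm{Gal}(M(\phi)/Q)$ and the restriction map $\mathrm{Gal}(Q(\mu_d)/Q)\to\mathrm{Gal}(M(\phi)/Q)$. It acts on $\mathcal{S}_{min}(N^{\mathrm{inv}})=\{g\in N\setminus\{e\}:\exp(g)=\exp(N)\}$ by $(x,y)\cdot g=x^{-1}g^yx$, and $b(\pi,\phi)$ is the number of orbits. Türkelli's constant is $b_T(G^{\mathrm{inv}},Q)=\max_{\pi,\phi}b(\pi,\phi)$, where $\pi$ ranges over all quotient maps $G\to G/N$ with $\exp(N)=\exp(G)$ and $\phi$ ranges over all continuous surjections $\phi:G_Q\to G/N$ that factor through $\mathrm{Gal}(Q(\mu_\infty)/Q)$. *)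

(* Defs.v *)
From HB Require Import structures.
From mathcomp Require Import all_boot all_algebra all_fingroup all_field.
From mathcomp Require Import boolp.

Set Implicit Arguments.
Unset Strict Implicit.
Unset Printing Implicit Defensive.

Import GroupScope GRing.Theory.

Definition is_max (P : nat -> Prop) (m : nat) : Prop :=
  P m /\ forall k, P k -> k <= m.

(* In MathComp a fieldExtType is a finite extension. *)
Definition global_field (Q : fieldType) : Prop :=
  (exists (L : fieldExtType rat) (f : {rmorphism L -> Q}), bijective f) \/
  (exists p : nat, prime p /\
     exists (L : fieldExtType {fraction {poly 'F_p}}) (f : {rmorphism L -> Q}),
       bijective f).

Definition is_separable_closure (Q K : fieldType) (iota : {rmorphism Q -> K}) :
    Prop :=
  (forall x : K, exists2 p : {poly Q}, separable_poly p & root (map_poly iota p) x)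
  /\
  (forall p : {poly K}, separable_poly p -> 1 < size p -> exists x, root p x).

Section Galois.
Variables (F L : fieldType) (i : {rmorphism F -> L}).

Record galois_aut : Type := Gal {
  gal_mor :> {rmorphism L -> L};
  gal_bij : bijective gal_mor;
  gal_fix : forall a, gal_mor (i a) = i a }.

Lemma gal_eq (s t : galois_aut) : (forall x, s x = t x) -> s = t.
Proof.
case: s t => [s sb sf] [t tb tf] /= st.
have E : s = t.
  have Ef : (s : L -> L) = t by apply/funext.
  case: s t Ef {sb sf tb tf st} => [f cf] [g cg] /= Ef; case: _ / Ef cg => cg.
  case: cf cg => [[c1] [c2]] [[d1] [d2]].
  by rewrite (Prop_irrelevance c1 d1) (Prop_irrelevance c2 d2).
case: _ / E tb tf => tb tf.
by rewrite (Prop_irrelevance sb tb) (Prop_irrelevance sf tf).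
Qed.

HB.instance Definition _ := gen_eqMixin galois_aut.
HB.instance Definition _ := gen_choiceMixin galois_aut.

Definition gal1 : galois_aut := @Gal idfun (Bijective (frefl _) (frefl _)) (frefl _).

Lemma gal_mul_fix (s t : galois_aut) a : (s \o t) (i a) = i a.
Proof. by rewrite /= !gal_fix. Qed.

(* The product is composition, (s * t) x = s (t x); this is opposite to the
   convention of 'Gal(E / F) in mathcomp.field.galois. *)
Definition gal_mul (s t : galois_aut) : galois_aut :=
  @Gal (s \o t) (bij_comp (gal_bij s) (gal_bij t)) (gal_mul_fix s t).

Lemma gal_inv_ex (s : galois_aut) : exists t : galois_aut, cancel s t /\ cancel t s.
Proof.
have [g sg gs] := gal_bij s.
have gB : zmod_morphism g.
  by move=> x y; apply: (can_inj sg); rewrite rmorphB !gs.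
have gM : monoid_morphism g.
  split; first by apply: (can_inj sg); rewrite gs rmorph1.
  by move=> x y; apply: (can_inj sg); rewrite rmorphM !gs.
pose gm := GRing.isZmodMorphism.Build _ _ g gB.
pose gn := GRing.isMonoidMorphism.Build _ _ g gM.
pose h : {rmorphism L -> L} := HB.pack g gm gn.
have hfix a : h (i a) = i a by apply: (can_inj sg); rewrite gs gal_fix.
by exists (@Gal h (Bijective gs sg) hfix).
Qed.

Definition gal_inv (s : galois_aut) : galois_aut := projT1 (cid (gal_inv_ex s)).

Lemma gal_mulA : associative gal_mul.
Proof. by move=> s t u; apply: gal_eq. Qed.

Lemma gal_mul1 : left_id gal1 gal_mul.
Proof. by move=> s; apply: gal_eq. Qed.

Lemma gal_1mul : right_id gal1 gal_mul.
Proof. by move=> s; apply: gal_eq. Qed.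

Lemma gal_mulV : left_inverse gal1 gal_inv gal_mul.
Proof.
by move=> s; apply: gal_eq => x; have [+ _] := projT2 (cid (gal_inv_ex s)); apply.
Qed.

Lemma gal_Vmul : right_inverse gal1 gal_inv gal_mul.
Proof.
by move=> s; apply: gal_eq => x; have [_ +] := projT2 (cid (gal_inv_ex s)); apply.
Qed.

HB.instance Definition _ :=
  isGroup.Build galois_aut gal_mulA gal_mul1 gal_1mul gal_mulV gal_Vmul.

(* Basic neighbourhoods of s in the Krull topology: the automorphisms agreeing
   with s on a finite list of elements. *)
Definition krull_open (U : galois_aut -> Prop) : Prop :=
  forall s, U s ->
  exists c : seq L, forall t : galois_aut, {in c, forall x, t x = s x} -> U t.

Definition krull_continuous (T : Type) (f : galois_aut -> T) : Prop :=
  forall A : T -> Prop, krull_open (fun s => A (f s)).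

End Galois.

Section Intermediate.
Variables (Q K : fieldType) (iota : {rmorphism Q -> K}).

Record intermediate : Type := Intermediate {
  ipred :> {pred K};
  ipred_divring : divring_closed ipred;
  ipred_base : forall a, iota a \in ipred }.

HB.instance Definition _ (E : intermediate) :=
  GRing.isDivringClosed.Build K (ipred E) (ipred_divring E).

Section Field.
Variable E : intermediate.

Record ifield : Type := IField { ival : K; ivalP : ival \in ipred E }.

HB.instance Definition _ := [isSub for ival].
HB.instance Definition _ := [Choice of ifield by <:].
HB.instance Definition _ := [SubChoice_isSubComUnitRing of ifield by <:].
HB.instance Definition _ := [SubComUnitRing_isSubIntegralDomain of ifield by <:].
HB.instance Definition _ := [SubIntegralDomain_isSubField of ifield by <:].

Definition ibase (a : Q) : ifield := IField (ipred_base E a).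

Lemma ibase_zmod : zmod_morphism ibase.
Proof. by move=> a b; apply: val_inj; rewrite /= !rmorphB. Qed.

Lemma ibase_monoid : monoid_morphism ibase.
Proof.
by split=> [|a b]; apply: val_inj; rewrite /= ?rmorph1 ?rmorphM.
Qed.

HB.instance Definition _ := GRing.isZmodMorphism.Build Q ifield ibase ibase_zmod.
HB.instance Definition _ :=
  GRing.isMonoidMorphism.Build Q ifield ibase ibase_monoid.

End Field.

Definition Gal_over (E : intermediate) := galois_aut (ibase E).

Definition restricts (E : intermediate) (tau : galois_aut iota) (rho : Gal_over E) :=
  forall x : ifield E, tau (ival x) = ival (rho x).

(* For E contained in E', rho is the restriction of sigma to E. *)
Definition restricts_sub (E' E : intermediate)
    (sigma : Gal_over E') (rho : Gal_over E) :=
  forall (y : ifield E') (x : ifield E),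
    ival y = ival x -> ival (sigma y) = ival (rho x).

Definition adjoin_pred (S : K -> Prop) : {pred K} :=
  fun x => `[< forall E : intermediate, (forall z, S z -> z \in E) -> x \in E >].

Lemma adjoin_divring S : divring_closed (adjoin_pred S).
Proof.
split=> [|x y /asboolP xS /asboolP yS|x y /asboolP xS /asboolP yS];
  apply/asboolP => E SE.
- exact: rpred1.
- by apply: rpredB; [apply: xS | apply: yS].
- by apply: rpred_div; [apply: xS | apply: yS].
Qed.

Lemma adjoin_base S a : iota a \in adjoin_pred S.
Proof. by apply/asboolP => E _; apply: ipred_base. Qed.

Definition adjoin (S : K -> Prop) : intermediate :=
  Intermediate (@adjoin_divring S) (@adjoin_base S).

Definition Qmu (m : nat) : intermediate :=
  adjoin (fun z => (z ^+ m)%R = 1%R).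

Definition Qmu_infty : intermediate :=
  adjoin (fun z => exists2 m : nat, 0 < m & (z ^+ m)%R = 1%R).

Definition meet_pred (E E' : intermediate) : {pred K} :=
  fun x => (x \in E) && (x \in E').

Lemma meet_divring (E E' : intermediate) : divring_closed (meet_pred E E').
Proof.
split=> [|x y /andP[xE xE'] /andP[yE yE']|x y /andP[xE xE'] /andP[yE yE']];
  by apply/andP; split; rewrite ?rpred1 ?rpredB ?rpred_div.
Qed.

Lemma meet_base (E E' : intermediate) a : iota a \in meet_pred E E'.
Proof. by apply/andP; split; apply: ipred_base. Qed.

Definition meet_field (E E' : intermediate) : intermediate :=
  Intermediate (meet_divring E E') (meet_base E E').

Definition fixed_pred (H : galois_aut iota -> Prop) : {pred K} :=
  fun x => `[< forall s : galois_aut iota, H s -> s x = x >].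

Lemma fixed_divring H : divring_closed (fixed_pred H).
Proof.
split=> [|x y /asboolP xH /asboolP yH|x y /asboolP xH /asboolP yH];
  apply/asboolP => s Hs.
- by rewrite rmorph1.
- by rewrite rmorphB xH ?yH.
- by rewrite fmorph_div xH ?yH.
Qed.

Lemma fixed_base H a : iota a \in fixed_pred H.
Proof. by apply/asboolP => s _; apply: gal_fix. Qed.

Definition fixed_field (H : galois_aut iota -> Prop) : intermediate :=
  Intermediate (@fixed_divring H) (@fixed_base H).

End Intermediate.

Section Exponent.
Variables (gT : finGroupType) (G : {group gT}).

(* A function on the nonidentity conjugacy classes of G, given as a class
   function; its values outside G^# are irrelevant. *)
Record exponent_function : Type := ExponentFunction {
  expf :> gT -> nat;
  expf_class : forall g x, g \in G^# -> x \in G -> expf (g ^ x) = expf g;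
  expf_gt0 : forall g, g \in G^# -> 0 < expf g;
  expf_power : forall g k, g \in G^# -> coprime k #[g] -> expf (g ^+ k) = expf g }.

Variable e : exponent_function.

(* exp(N); the initial value of the iterated minimum is the maximum of the same
   values, so for N nontrivial this is the minimum over N^#. *)
Definition exp_of (N : {group gT}) : nat :=
  \big[minn/(\max_(g in N^#) e g)%N]_(g in N^#) e g.

Definition Smin (N : {group gT}) : {set gT} :=
  [set g in N^# | e g == exp_of N].

Definition dG : nat := \big[lcmn/1%N]_(g in Smin G) #[g].

End Exponent.

Section Turkelli.
Variables (gT : finGroupType) (G : {group gT}) (e : exponent_function G).
Variables (Q K : fieldType) (iota : {rmorphism Q -> K}).

Local Notation d := (dG e).

Section Constant.
Variables (N : {group gT}) (phi : {multiplicative galois_aut iota -> coset_of N}).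

Definition continuous_surjection : Prop :=
  [/\ krull_continuous phi,
      forall tau, phi tau \in G / N
    & forall c, c \in G / N -> exists tau, phi tau = c].

(* Restriction to a normal E is onto, so psi is automatically a continuous
   homomorphism. *)
Definition factors_through (E : intermediate iota) : Prop :=
  exists psi : Gal_over E -> coset_of N,
    forall tau : galois_aut iota,
    exists2 sigma : Gal_over E, restricts tau sigma & phi tau = psi sigma.

Definition Qphi : intermediate iota := fixed_field (fun tau => phi tau = 1).

Definition Mphi : intermediate iota := meet_field Qphi (Qmu iota d).

(* The fibre product of G and Gal(Q(mu_d)/Q) over Gal(M(phi)/Q).  The
   isomorphism G / N ~ Gal(Q(phi)/Q) is the inverse of the one induced by phi,
   so x is sent to the restriction to M(phi) of any tau with phi tau = x N. *)
Definition in_fibre_product (x : gT) (sigma : Gal_over (Qmu iota d)) :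
    Prop :=
  x \in G /\
  exists rho : Gal_over Mphi,
    (exists2 tau : galois_aut iota, phi tau = coset N x & restricts tau rho)
    /\ restricts_sub sigma rho.

(* y is the image of sigma under Gal(Q(mu_d)/Q) -> (Z/d)^* *)
Definition cyclotomic_char (sigma : Gal_over (Qmu iota d))
    (y : {unit 'Z_d}) : Prop :=
  forall z : ifield (Qmu iota d),
    (z ^+ d)%R = 1%R -> sigma z = (z ^+ (val y : nat))%R.

(* G(pi, phi) as a subset of G x (Z/d)^*; for G nontrivial one has 1 < d, so
   that 'Z_d is Z/d *)
Definition Gpiphi : {set gT * {unit 'Z_d}} :=
  [set xy | `[< exists2 sigma : Gal_over (Qmu iota d),
                  in_fibre_product xy.1 sigma & cyclotomic_char sigma xy.2 >]].

(* (x, y) . g = x^-1 g^y x; the order of g in Smin e N divides d when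
   exp(N) = exp(G) *)
Definition Gpiphi_act (g : gT) (xy : gT * {unit 'Z_d}) : gT :=
  (g ^+ (val xy.2 : nat)) ^ xy.1.

Definition b_const : nat :=
  #|[set [set Gpiphi_act g xy | xy in Gpiphi] | g in Smin e N]|.

End Constant.

(* k = b(pi, phi) for some pi : G -> G / N with exp(N) = exp(G) and some phi
   factoring through Gal(E/Q) *)
Definition b_value (E : intermediate iota) (k : nat) : Prop :=
  exists (N : {group gT}) (phi : {multiplicative galois_aut iota -> coset_of N}),
    [/\ [/\ N <| G, N :!=: 1 & exp_of e N = exp_of e G],
        continuous_surjection phi,
        factors_through phi E
      & k = b_const phi].

(* m = b_T(G^inv, Q) *)
Definition is_turkelli_constant (m : nat) : Prop :=
  is_max (b_value (Qmu_infty iota)) m.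

End Turkelli.

(* Main.v *)
(* Given (pi, phi), let N' / N be the image under phi of the automorphisms
   fixing M(phi), and let phi' be the induced map to G / N'.  Its kernel is the
   group of automorphisms fixing M(phi), so phi' factors through Gal(Q(mu_d)/Q).
   As M(phi) is contained in M(phi'), the group G(pi', phi') is contained in
   G(pi, phi), while Smin(N) is contained in Smin(N'); hence
   b(pi, phi) <= b(pi', phi').  Only this inclusion of fibre products is used,
   so no extension of automorphisms to the separable closure is needed. *)
Require Import Defs.
From HB Require Import structures.
From mathcomp Require Import all_boot all_algebra all_fingroup all_field.
From mathcomp Require Import cyclic boolp.

Set Implicit Arguments.
Unset Strict Implicit.
Unset Printing Implicit Defensive.

Import GroupScope GRing.Theory.

Lemma is_max_exists (P : nat -> Prop) (M : nat) :
  (exists k, P k) -> (forall k, P k -> k <= M) -> exists m, is_max P m.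
Proof.
move=> [k Pk] PM.
have exP : exists k, `[< P k >] by exists k; apply/asboolP.
have ubP k' : `[< P k' >] -> k' <= M by move/asboolP/PM.
case: (ex_maxnP exP ubP) => m /asboolP Pm maxm.
by exists m; split=> // k' /asboolP/maxm.
Qed.

(** * Stable intermediate fields and factorisation through their automorphism groups *)

Section StableFields.
Variables (Q K : fieldType) (iota : {rmorphism Q -> K}).
Implicit Types (E : intermediate iota) (s t tau : galois_aut iota).

(** Stands in for normality over [Q]: automorphisms of [K] can be restricted to such an [E]. *)
Definition stable E := forall tau x, x \in E -> tau x \in E.

Lemma gal_invK tau : cancel tau tau^-1.
Proof. by move=> x; rewrite -[LHS]/((tau^-1 * tau) x) mulVg. Qed.

Lemma gal_divE s t x : (s^-1 * t) x = x <-> t x = s x.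
Proof.
split=> [stx|tsx]; last by rewrite -[LHS]/(s^-1 (t x)) tsx gal_invK.
by rewrite -[in RHS]stx -[RHS]/((s * (s^-1 * t)) x) mulgA mulgV mul1g.
Qed.

Lemma stable_adjoin S :
  (forall tau z, S z -> S (tau z)) -> stable (adjoin iota S).
Proof.
move=> Sstab tau x /asboolP xS; apply/asboolP => E SE.
(* The preimage of [E] under [tau] is itself an intermediate field containing [S], so it contains
   [x]. *)
pose A : {pred K} := fun y => tau y \in E.
have A_divring : divring_closed A.
  split=> [|y z yA zA|y z yA zA]; rewrite unfold_in.
  - by rewrite rmorph1 rpred1.
  - by rewrite rmorphB rpredB.
  - by rewrite fmorph_div rpred_div.
have A_base a : iota a \in A by rewrite unfold_in gal_fix ipred_base.
by apply: (xS (Intermediate A_divring A_base)) => z /(Sstab tau)/SE.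
Qed.

Lemma adjoin_sub S S' :
  (forall z, S z -> S' z) -> {subset adjoin iota S <= adjoin iota S'}.
Proof.
by move=> SS' x /asboolP xS; apply/asboolP => E S'E; apply: xS => z /SS'/S'E.
Qed.

Lemma stable_Qmu m : stable (Qmu iota m).
Proof. by apply: stable_adjoin => tau z zm; rewrite -rmorphXn zm rmorph1. Qed.

Lemma stable_Qmu_infty : stable (Qmu_infty iota).
Proof.
apply: stable_adjoin => tau z [m m0 zm].
by exists m => //; rewrite -rmorphXn zm rmorph1.
Qed.

Lemma Qmu_sub_infty m : 0 < m -> {subset Qmu iota m <= Qmu_infty iota}.
Proof. by move=> m0; apply: adjoin_sub => z zm; exists m. Qed.

Lemma stable_meet E E' : stable E -> stable E' -> stable (meet_field E E').
Proof.
by move=> sE sE' tau x /andP[xE xE']; apply/andP; split; [apply: sE|apply: sE'].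
Qed.

Lemma restricts_exists E tau :
  stable E -> exists rho : Gal_over E, restricts tau rho.
Proof.
move=> sE.
(* The map is built for every automorphism at once, because the inverse of [f tau] is [f tau^-1]. *)
pose f t (x : ifield E) : ifield E := IField (sE t _ (ivalP x)).
have fB t : zmod_morphism (f t) by move=> x y; apply: val_inj; rewrite /= rmorphB.
have fM t : monoid_morphism (f t).
  by split=> [|x y]; apply: val_inj; rewrite /= ?rmorph1 ?rmorphM.
pose h t : {rmorphism ifield E -> ifield E} :=
  HB.pack (f t) (GRing.isZmodMorphism.Build _ _ (f t) (fB t))
    (GRing.isMonoidMorphism.Build _ _ (f t) (fM t)).
have hbij : bijective (h tau).
  exists (h tau^-1) => x; apply: val_inj; rewrite /= ?gal_invK //.
  by rewrite -{1}[tau]invgK gal_invK.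
have hfix a : h tau (ibase E a) = ibase E a.
  by apply: val_inj; rewrite /= gal_fix.
by exists (Defs.Gal hbij hfix).
Qed.

Lemma restricts_agree E s t (rho : Gal_over E) :
  restricts s rho -> restricts t rho -> {in E, s =1 t}.
Proof. by move=> sr tr x xE; rewrite (sr (IField xE)) (tr (IField xE)). Qed.

Lemma restricts_eq E s t (sigma rho : Gal_over E) :
  restricts s sigma -> restricts t rho -> {in E, s =1 t} -> sigma = rho.
Proof.
move=> ss tr st; apply: gal_eq => x; apply: val_inj.
by rewrite /= -ss -tr st // ivalP.
Qed.

Section Phi.
Variables (gT : finGroupType) (N : {group gT}).
Variable phi : {multiplicative galois_aut iota -> coset_of N}.

Lemma gal_mor1 : phi 1 = 1.
Proof. by apply: (mulgI (phi 1)); rewrite -gmulfM !mulg1. Qed.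

Lemma gal_morV s : phi s^-1 = (phi s)^-1.
Proof. by apply: (mulgI (phi s)); rewrite -gmulfM !mulgV gal_mor1. Qed.

(** The kernel of [phi] is normal, so its fixed field is stable. *)
Lemma stable_Qphi : stable (Qphi phi).
Proof.
move=> tau x /asboolP xQ; apply/asboolP => s phis.
apply/(gal_divE tau (s * tau)); apply: xQ.
by rewrite !gmulfM gal_morV phis mul1g mulVg.
Qed.

(** As every automorphism restricts to a stable [E], the existence of [psi] amounts to [phi]
    depending only on the restriction. *)
Lemma factors_throughP E : stable E ->
  factors_through phi E <->
  (forall s t, {in E, s =1 t} -> phi s = phi t).
Proof.
move=> sE; split=> [[psi psiP] s t st|agree].
  have [sigma ss ->] := psiP s; have [rho tr ->] := psiP t.
  by rewrite (restricts_eq ss tr st).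
(* [psi] evaluates [phi] at a chosen extension to [K]; an automorphism of [E] without extension gets
   the default value 1. *)
exists (fun sigma : Gal_over E =>
  if pselect (exists t, restricts t sigma) is left h then phi (projT1 (cid h))
  else 1) => tau.
have [sigma ts] := restricts_exists tau sE; exists sigma => //.
case: pselect => [h|[]]; last by exists tau.
by case: cid => t /= tr; apply: agree; apply: restricts_agree ts tr.
Qed.

Lemma factors_through_sub E E' : stable E -> stable E' -> {subset E <= E'} ->
  factors_through phi E -> factors_through phi E'.
Proof.
move=> sE sE' EE' /(factors_throughP sE) agree; apply/(factors_throughP sE').
by move=> s t st; apply: agree => x /EE'/st.
Qed.

End Phi.
End StableFields.

(** * Minimal exponents and the integer d *)

Section Exponents.
Variables (gT : finGroupType) (G : {group gT}) (e : exponent_function G).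
Implicit Types N : {group gT}.

Lemma exp_of_le N g : g \in N^# -> exp_of e N <= e g.
Proof.
rewrite /exp_of; move: (\max_(_ in _) _)%N (mem_index_enum g) => M + gN.
elim: (index_enum _) => //= h r IHr; rewrite big_cons inE.
by case/predU1P=> [<-|/IHr le]; [rewrite gN geq_minl|case: ifP => // _; rewrite geq_min le orbT].
Qed.

Lemma exp_of_attained N : N :!=: 1 -> exists2 g, g \in N^# & e g = exp_of e N.
Proof.
move=> /trivgPn[h hN h1].
have {h1} {}hN : h \in N^# by rewrite !inE h1.
pose g := [arg min_(g < h in N^#) e g]%N.
have [gN gmin] : g \in N^# /\ forall g', g' \in N^# -> e g <= e g'.
  by rewrite /g; case: arg_minnP.
exists g => //; apply/eqP; rewrite eqn_leq exp_of_le // andbT /exp_of.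
(* The initial value of the iterated minimum is a maximum over [N^#], hence also at least [e g]. *)
apply: (big_ind (fun m => e g <= m)) => //.
  exact: (leq_bigmax_cond (F := e)).
by move=> m m'; rewrite leq_min => -> ->.
Qed.

(** A minimum can only drop on a larger set, so the exponent of [N'] is squeezed between those of
    [G] and [N]. *)
Lemma exp_of_between N N' : N :!=: 1 -> N \subset N' -> N' \subset G ->
  exp_of e N = exp_of e G -> exp_of e N' = exp_of e G.
Proof.
move=> N1 NN' N'G NG; have [g gN eg] := exp_of_attained N1.
have N'1 : N' :!=: 1 by apply: contraNneq N1 => N'1; rewrite -subG1 -N'1.
have [g' g'N' eg'] := exp_of_attained N'1.
apply/eqP; rewrite eqn_leq; apply/andP; split.
  by rewrite -NG -eg exp_of_le // (subsetP (setSD _ NN')).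
by rewrite -eg' exp_of_le // (subsetP (setSD _ N'G)).
Qed.

Lemma Smin_sub N N' : N \subset N' -> exp_of e N = exp_of e N' ->
  Smin e N \subset Smin e N'.
Proof.
move=> NN' eNN'; apply/subsetP => g; rewrite !in_set eNN' => /andP[/andP[-> gN] ->].
by rewrite (subsetP NN').
Qed.

Lemma dG_gt0 : 0 < dG e.
Proof.
apply: (big_ind (fun m => 0 < m)) => // m m' m0 m'0.
by rewrite lcmn_gt0 m0.
Qed.

Lemma order_dvd_dG g : g \in Smin e G -> #[g] %| dG e.
Proof. by move=> gS; rewrite /dG (bigD1 g) //= dvdn_lcml. Qed.

Lemma dG_gt1 : G :!=: 1 -> 1 < dG e.
Proof.
move=> G1; have [g gG eg] := exp_of_attained G1.
have /order_dvd_dG : g \in Smin e G by rewrite inE gG eg eqxx.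
move/(dvdn_leq dG_gt0); apply: leq_trans.
by rewrite order_gt1; case/setD1P: gG.
Qed.

End Exponents.

(** * The fibre product, its action and the comparison of orbit counts *)

Section FibreProduct.
Variables (gT : finGroupType) (G : {group gT}) (e : exponent_function G).
Variables (Q K : fieldType) (iota : {rmorphism Q -> K}).
Hypothesis G1 : G :!=: 1.
Local Notation d := (dG e).

(** The modulus built into ['Z_d] is d itself because 1 < d for nontrivial [G]. *)
Lemma dG_trunc : (Zp_trunc d).+2 = d.
Proof. by rewrite Zp_cast ?dG_gt1. Qed.

(** Reducing the product of two exponents modulo d leaves the power of [g] unchanged, since the
    order of [g] divides d. *)
Lemma Gpiphi_actM g (a b : gT * {unit 'Z_d}) : #[g] %| d ->
  Gpiphi_act g (a * b) = Gpiphi_act (Gpiphi_act g a) b.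
Proof.
move=> gd; rewrite /Gpiphi_act /= -conjXg -expgM -conjgM; congr (_ ^ _).
by apply: expg_mod; rewrite dG_trunc; apply/eqP; rewrite -order_dvdn.
Qed.

Lemma Gpiphi_act1 g : Gpiphi_act g (1 : gT * {unit 'Z_d}) = g.
Proof. by rewrite /Gpiphi_act /= expg1 conjg1. Qed.

Section OnePhi.
Variables (N : {group gT}) (phi : {multiplicative galois_aut iota -> coset_of N}).
Hypothesis nN : G \subset 'N(N).

Lemma stable_Mphi : stable (Mphi e phi).
Proof. by apply: stable_meet; [apply: stable_Qphi | apply: stable_Qmu]. Qed.

Lemma Gpiphi1 : 1 \in Gpiphi e phi.
Proof.
rewrite inE; apply/asboolP; exists 1.
  split; first exact: group1.
  exists 1; split; last by move=> y x /=.
  by exists 1 => //; rewrite gal_mor1 morph1.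
by move=> z zd; rewrite /= expr1.
Qed.

Lemma GpiphiM a b : a \in Gpiphi e phi -> b \in Gpiphi e phi ->
  a * b \in Gpiphi e phi.
Proof.
rewrite !inE => /asboolP[s [aG [r [[t ta tr] sr]]] sa].
move=> /asboolP[s' [bG [r' [[t' tb tr'] sr']]] sb]; apply/asboolP.
exists (s * s'); last first.
  move=> z zd; rewrite -[LHS]/(s (s' z)) sb // rmorphXn sa //=.
  by rewrite -exprM; apply/esym/expr_mod; rewrite dG_trunc.
split; first exact: groupM.
exists (r * r'); split; last by move=> y x /sr'/sr.
exists (t * t'); first by rewrite gmulfM ta tb morphM ?(subsetP nN).
by move=> x; rewrite -[LHS]/(t (t' (ival x))) tr' tr.
Qed.

End OnePhi.

(** Each orbit of the smaller group lies in one orbit of the larger, so on [Smin e N] the larger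
    group has at most as many orbits; enlarging to [Smin e N'] can only add orbits. *)
Lemma b_const_le (N N' : {group gT})
    (phi : {multiplicative galois_aut iota -> coset_of N})
    (phi' : {multiplicative galois_aut iota -> coset_of N'}) :
  G \subset 'N(N) -> Smin e N \subset Smin e N' -> Smin e N \subset Smin e G ->
  Gpiphi e phi' \subset Gpiphi e phi -> b_const e phi <= b_const e phi'.
Proof.
move=> nN SN' SG sub; rewrite /b_const.
pose orb (A : {set gT * {unit 'Z_d}}) g := [set Gpiphi_act g xy | xy in A].
(* [F] saturates a small orbit under the larger group; it sends the small orbit of [g] to the large
   orbit of [g]. *)
pose F (O : {set gT}) := \bigcup_(h in O) orb (Gpiphi e phi) h.
have FE g : g \in Smin e N -> F (orb (Gpiphi e phi') g) = orb (Gpiphi e phi) g.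
  move=> gN; have gd := order_dvd_dG (subsetP SG _ gN).
  apply/eqP; rewrite eqEsubset; apply/andP; split; last first.
    apply: (bigcup_sup g) => //; apply/imsetP; exists 1; rewrite ?Gpiphi_act1 //.
    exact: Gpiphi1.
  apply/bigcupsP => _ /imsetP[a a' ->]; apply/subsetP => _ /imsetP[b b' ->].
  rewrite -Gpiphi_actM //; apply: imset_f.
  by apply: GpiphiM => //; apply: (subsetP sub).
(* The set of large orbits is the image under [F] of the set of small ones. *)
rewrite -/(orb _) -(eq_in_imset FE) (imset_comp F).
apply: leq_trans (leq_imset_card _ _) _.
exact: subset_leq_card (imsetS _ SN').
Qed.

End FibreProduct.

(** * Descent from [phi] to a surjection with kernel the automorphisms fixing M(phi) *)

Section Descent.
Variables (gT : finGroupType) (G : {group gT}) (e : exponent_function G).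
Variables (Q K : fieldType) (iota : {rmorphism Q -> K}) (N : {group gT}).
Variable phi : {multiplicative galois_aut iota -> coset_of N}.
Hypotheses (nNG : N <| G) (phi_onto : continuous_surjection G phi).

Implicit Types (s t : galois_aut iota) (x y : gT).

Definition fixesM t := {in Mphi e phi, forall z, t z = z}.

Lemma fixesM_conj s t : fixesM t -> fixesM (s^-1 * t * s).
Proof.
move=> tM z zM; rewrite -mulgA; apply/(gal_divE s (t * s)).
by rewrite -[LHS]/(t (s z)) tM //; apply: stable_Mphi.
Qed.

Lemma fixesM_mul s t : fixesM s -> fixesM t -> fixesM (s * t).
Proof. by move=> sM tM z zM; rewrite -[LHS]/(s (t z)) tM ?sM. Qed.

Lemma fixesM_ker t : phi t = 1 -> fixesM t.
Proof. by move=> t1 z /andP[/asboolP zQ _]; apply: zQ. Qed.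

(** [s^-1 * t] lies in the kernel of [phi], which fixes Q(phi) and hence M(phi). *)
Lemma fixesM_eq s t : phi s = phi t -> fixesM s -> fixesM t.
Proof.
move=> st sM; rewrite -[t](mulKVg s); apply: fixesM_mul => //.
by apply: fixesM_ker; rewrite gmulfM gal_morV st mulVg.
Qed.

(** The underlying set of N', as a full preimage in [G]. *)
Definition descent_set : {set gT} :=
  [set x in G | `[< exists2 t, phi t = coset N x & fixesM t >]].

Lemma mem_normN x : x \in G -> x \in 'N(N).
Proof. by case/andP: nNG => _ /subsetP; apply. Qed.

Lemma descent_group_set : group_set descent_set.
Proof.
apply/group_setP; split.
  rewrite inE group1; apply/asboolP; exists 1; first by rewrite gal_mor1 morph1.
  by [].
move=> x y; rewrite !inE => /andP[xG /asboolP[s sx sM]] /andP[yG /asboolP[t ty tM]].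
rewrite groupM //; apply/asboolP; exists (s * t); last exact: fixesM_mul.
by rewrite gmulfM sx ty morphM ?mem_normN.
Qed.
Canonical descent := Group descent_group_set.

Lemma phi_repr t : exists2 x, x \in G & phi t = coset N x.
Proof.
have [_ /(_ t) + _] := phi_onto; case/morphimP => x _ xG ->; by exists x.
Qed.

Lemma phi_lift x : x \in G -> exists t, phi t = coset N x.
Proof. by move=> xG; have [_ _] := phi_onto; apply; apply: mem_quotient. Qed.

(** By [fixesM_eq], any single lift of the coset of [x] decides membership. *)
Lemma mem_descent t x :
  x \in G -> phi t = coset N x -> (x \in descent) <-> fixesM t.
Proof.
move=> xG tx; rewrite inE xG /=; split=> [/asboolP[s sx]|tM].
  by apply: fixesM_eq; rewrite sx.
by apply/asboolP; exists t.
Qed.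

Lemma descent_sub : descent \subset G.
Proof. by apply/subsetP => x; rewrite inE => /andP[]. Qed.

Lemma sub_descent : N \subset descent.
Proof.
apply/subsetP => x xN; have xG := subsetP (normal_sub nNG) x xN.
have x1 : phi 1 = coset N x by rewrite gal_mor1 coset_id.
exact/(mem_descent xG x1).
Qed.

Lemma descent_normal : descent <| G.
Proof.
rewrite /normal descent_sub; apply/subsetP => y yG; rewrite inE.
apply/subsetP => _ /imsetP[x xD ->].
have xG := subsetP descent_sub x xD.
have [s sy] := phi_lift yG; have [t tx] := phi_lift xG.
have tM := (mem_descent xG tx).1 xD.
apply/(@mem_descent (s^-1 * t * s)); first exact: groupJ.
  by rewrite !gmulfM gal_morV sy tx morphJ ?mem_normN // /conjg mulgA.
exact: fixesM_conj.
Qed.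

(** This is phi': [phi] followed by the projection from G/N to G/N', computed on a representative;
    [coset_descent] shows that the choice is harmless. *)
Definition descent_fun t : coset_of descent := coset descent (repr (phi t)).

Lemma coset_descent x y : x \in G -> y \in G -> coset N x = coset N y ->
  coset descent x = coset descent y.
Proof.
move=> xG yG /kercoset_rcoset[]; rewrite ?mem_normN // => z zN ->.
have zD := subsetP sub_descent z zN.
have nD : G \subset 'N(descent) := normal_norm descent_normal.
have zG := subsetP descent_sub z zD.
by rewrite morphM ?(subsetP nD) //= (coset_id zD) mul1g.
Qed.

Lemma descent_funE t x :
  x \in G -> phi t = coset N x -> descent_fun t = coset descent x.
Proof.
move=> xG tx; apply: coset_descent => //; last by rewrite coset_reprK.
have : repr (phi t) \in phi t := mem_repr_coset _.
have : coset N (repr (phi t)) \in G / N by rewrite coset_reprK tx mem_quotient.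
case/morphimP => y yN yG /kercoset_rcoset[] //; first by rewrite repr_coset_norm.
by move=> z zN -> _; rewrite groupM // (subsetP (normal_sub nNG)).
Qed.

Lemma descent_funM : {morph descent_fun : s t / s * t}.
Proof.
move=> s t; have [x xG sx] := phi_repr s; have [y yG ty] := phi_repr t.
rewrite (descent_funE xG sx) (descent_funE yG ty) -morphM; last 2 first.
- by rewrite (subsetP (normal_norm descent_normal)).
- by rewrite (subsetP (normal_norm descent_normal)).
by apply: descent_funE; rewrite ?groupM // gmulfM sx ty morphM ?mem_normN.
Qed.

HB.instance Definition _ :=
  isMultiplicative.Build (galois_aut iota) (coset_of descent) descent_fun descent_funM.
Definition descent_mor : {multiplicative galois_aut iota -> coset_of descent} :=
  descent_fun.

Lemma descent_surjection : continuous_surjection G descent_mor.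
Proof.
split.
(* Continuity is inherited because phi' is [phi] followed by a map on cosets. *)
- by have [cphi _ _] := phi_onto => A; apply: (cphi (fun c => A (coset descent (repr c)))).
- by move=> t; have [x xG tx] := phi_repr t; rewrite /= (descent_funE xG tx) mem_quotient.
- move=> _ /morphimP[x _ xG ->]; have [t tx] := phi_lift xG.
  by exists t; apply: descent_funE.
Qed.

(** Identifies the fibres of phi': its kernel consists exactly of the automorphisms fixing
    M(phi). *)
Lemma descent_eq s t : descent_mor s = descent_mor t <-> fixesM (s * t^-1).
Proof.
have [x xG sx] := phi_repr s; have [y yG ty] := phi_repr t.
have xy : phi (s * t^-1) = coset N (x * y^-1).
  by rewrite gmulfM gal_morV sx ty morphM ?morphV ?groupV ?mem_normN.
have nD := subsetP (normal_norm descent_normal).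
rewrite /= (descent_funE xG sx) (descent_funE yG ty).
have xyG : x * y^-1 \in G by rewrite groupM ?groupV.
apply: (iff_trans _ (mem_descent xyG xy)); rewrite -[_ \in _]mem_rcoset.
by apply: rwP; apply: rcoset_kercosetP; apply: nD.
Qed.

Lemma descent_factors : factors_through descent_mor (Qmu iota (dG e)).
Proof.
apply/(factors_throughP _ (@stable_Qmu _ _ _ _)) => s t st; apply/descent_eq.
(* Agreement on Q(mu_d) makes [t^-1 * s] trivial on M(phi), and [s * t^-1] is its conjugate by
   [t^-1]. *)
rewrite -[s](mulKVg t) -[t * _ * _]mulgA -{1}[t]invgK; apply: fixesM_conj.
by move=> x /andP[_ xQ]; apply/gal_divE/st.
Qed.

Lemma Mphi_sub : {subset Mphi e phi <= Mphi e descent_mor}.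
Proof.
move=> x xM; apply/andP; split; last by case/andP: xM.
apply/asboolP => s s1; have := (descent_eq s 1).1; rewrite gal_mor1 invg1 mulg1.
by apply.
Qed.

Lemma Gpiphi_descent : Gpiphi e descent_mor \subset Gpiphi e phi.
Proof.
apply/subsetP => a; rewrite !inE => /asboolP[s [aG [r [[t ta tr] sr]]] sa].
apply/asboolP; exists s => //; split=> //.
(* The given [t] lifts [a.1] only modulo N'. A lift [u] modulo N has the same image under phi', so
   it agrees with [t] on M(phi) and can replace it there. *)
have [u ua] := phi_lift aG.
have /descent_eq utM : descent_mor u = descent_mor t.
  by rewrite ta; apply: descent_funE.
have [r' ur'] := restricts_exists u (@stable_Mphi _ _ e _ _ _ _ phi).
exists r'; split; first by exists u.
move=> y x yx; have xM := ivalP x.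
rewrite (sr y (IField (Mphi_sub xM))) // -tr /= -ur'.
have tx : t (ival x) \in Mphi e phi by apply: stable_Mphi.
by have := utM _ tx; rewrite -[LHS]/(u (t^-1 (t (ival x)))) gal_invK => ->.
Qed.

End Descent.

(** * Existence and equality of the maxima over Q(mu_infty) and Q(mu_d) *)

Theorem theorem2p16 (n : nat) (G : {group 'S_n})
    (G_trans : [transitive G, on [set: 'I_n] | 'P]) (G_nt : G :!=: 1%g)
    (e : exponent_function G)
    (Q : fieldType) (Q_global : global_field Q)
    (Q_char : forall p : nat, p \in [pchar Q]%R -> coprime #|G| p)
    (K : fieldType) (iota : {rmorphism Q -> K})
    (K_sep : is_separable_closure iota) :
  exists m : nat,
    is_turkelli_constant e iota m /\
    is_max (b_value e (Qmu iota (dG e))) m.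
Proof.
have value_sub k : b_value e (Qmu iota (dG e)) k -> b_value e (Qmu_infty iota) k.
  move=> [N [phi [nN cphi fphi ->]]]; exists N, phi; split=> //.
  apply: factors_through_sub fphi; [exact: stable_Qmu|exact: stable_Qmu_infty|].
  exact: Qmu_sub_infty (dG_gt0 e).
have value_le k : b_value e (Qmu_infty iota) k ->
    exists2 k', b_value e (Qmu iota (dG e)) k' & k <= k'.
  move=> [N [phi [[nN N1 NG] cphi _ ->]]].
  pose D := descent e phi nN; pose psi := descent_mor e nN cphi.
  have ND : N \subset D := sub_descent e phi nN.
  have DG : exp_of e D = exp_of e G.
    exact: exp_of_between N1 ND (descent_sub e phi nN) NG.
  exists (b_const e psi).
    exists D, psi; split=> //.
    - split=> //; first exact: descent_normal.
      by apply: contraNneq N1 => D1; rewrite -subG1 -D1.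
    - exact: descent_surjection.
    - exact: descent_factors.
  apply: b_const_le => //; first exact: normal_norm.
  - by apply: Smin_sub; rewrite // NG.
  - by apply: Smin_sub; rewrite // (normal_sub nN).
  - exact: Gpiphi_descent.
(* Orbits are subsets of ['S_n], which bounds their number uniformly and lets the maximum exist. *)
have value_bound k : b_value e (Qmu iota (dG e)) k -> k <= #|{set 'S_n}|.
  by move=> [N [phi [_ _ _ ->]]]; apply: max_card.
(* The pair with N = G and trivial [phi] is always admissible, as [G] is nontrivial. *)
have value_ex : exists k, b_value e (Qmu iota (dG e)) k.
  have triv_mor : {morph (fun _ : galois_aut iota => 1 : coset_of G) : s t / s * t}.
    by move=> s t; rewrite mulg1.
  pose triv : {multiplicative galois_aut iota -> coset_of G} :=
    HB.pack (fun _ : galois_aut iota => 1 : coset_of G)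
      (isMultiplicative.Build (galois_aut iota) (coset_of G) _ triv_mor).
  exists (b_const e triv); exists G, triv; split=> //.
  - split; [by move=> A s As; exists [::]|by move=> t; apply: group1|].
    by move=> c; rewrite trivg_quotient => /set1P->; exists 1.
  - by apply/(factors_throughP _ (@stable_Qmu _ _ _ _)).
(* The maximum is taken over Q(mu_d); [value_sub] and [value_le] carry it over to Q(mu_infty). *)
have [m [vm maxm]] := is_max_exists value_ex value_bound.
exists m; split; split=> //; first exact: value_sub.
by move=> k /value_le[k' /maxm k'm kk']; apply: leq_trans kk' k'm.
Qed.
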